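(* Let $k\geq 1$ be an integer and let $d=k^{2}+1$. Then the fundamental solution of the equation $x^{2}-dy^{2}=1$ is $$x_{1}+y_{1}\sqrt{d}=2k^{2}+1+2k\sqrt{d}.$$
   Context: For a positive integer $d$ that is not a perfect square and a nonzero integer $N$, a pair $(a,b)$ of integers with $a^{2}-db^{2}=N$ is identified with $a+b\sqrt{d}$ and called a solution of $x^{2}-dy^{2}=N$; it is positive if $a>0$ and $b>0$. The fundamental solution of $x^{2}-dy^{2}=N$ is the positive solution $x_{1}+y_{1}\sqrt{d}$ such that $x_{1}+y_{1}\sqrt{d}<x_{2}+y_{2}\sqrt{d}$ for every other positive solution $x_{2}+y_{2}\sqrt{d}$ of the same equation. *)

(* Defs.v *)
From Stdlib Require Import ZArith Reals.

Definition is_solution (d N a b : Z) : Prop :=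
  (a ^ 2 - d * b ^ 2 = N)%Z.

(* The real number a + b sqrt d with which the pair (a, b) is identified;
   for d > 0 not a perfect square, it determines the pair. *)
Definition quad_val (d a b : Z) : R :=
  (IZR a + IZR b * sqrt (IZR d))%R.

Definition is_positive_solution (d N a b : Z) : Prop :=
  is_solution d N a b /\ (0 < a)%Z /\ (0 < b)%Z.

(* Meant for d > 0 not a perfect square and N <> 0.  The minimality is strict,
   so there is at most one fundamental solution. *)
Definition is_fundamental_solution (d N x1 y1 : Z) : Prop :=
  is_positive_solution d N x1 y1 /\
  forall x2 y2 : Z,
    is_positive_solution d N x2 y2 -> (x2, y2) <> (x1, y1) ->
    (quad_val d x1 y1 < quad_val d x2 y2)%R.

(* Main.v *)
Require Import Defs.
From Stdlib Require Import ZArith Reals Lia Lra.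

(** Since [d = k ^ 2 + 1], a solution satisfies
    [a ^ 2 = (k * b) ^ 2 + b ^ 2 + 1], so [a] exceeds [k * b], hence
    [k * b + 1 <= a] by integrality.  Squaring gives [2 * k * b <= b ^ 2],
    that is [2 * k <= b], and then [2 * k ^ 2 + 1 <= a]
    ([positive_solution_lower_bound]).  The claimed solution is thus the least
    one in each coordinate separately, and [a + b * sqrt d] is strictly
    increasing in [a] and in [b] ([quad_val_lt]). *)

Lemma positive_solution_lower_bound (k a b : Z) :
  (1 <= k)%Z -> is_positive_solution (k ^ 2 + 1) 1 a b ->
  (2 * k ^ 2 + 1 <= a)%Z /\ (2 * k <= b)%Z.
Proof.
  unfold is_positive_solution, is_solution.
  intros hk [E [ha hb]].
  assert (hab : (k * b + 1 <= a)%Z) by nia.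
  assert (hkb : (2 * k <= b)%Z) by nia.
  split; nia.
Qed.

Lemma quad_val_lt (d a b a' b' : Z) :
  (0 < d)%Z -> (a <= a')%Z -> (b <= b')%Z -> (a', b') <> (a, b) ->
  (quad_val d a b < quad_val d a' b')%R.
Proof.
  intros hd ha hb hne; unfold quad_val.
  assert (hs : (0 < sqrt (IZR d))%R) by now apply sqrt_lt_R0, IZR_lt.
  destruct (Z.eq_dec b' b) as [-> | hbb].
  - assert (hlt : (a < a')%Z).
    { assert (a' <> a) by (intros ->; now apply hne). lia. }
    apply IZR_lt in hlt; lra.
  - assert (hlt : (b < b')%Z) by lia.
    apply IZR_lt in hlt; apply IZR_le in ha; nra.
Qed.

Theorem corollary5 (k d : Z) (hk : (1 <= k)%Z) (hd : d = (k ^ 2 + 1)%Z) :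
  is_fundamental_solution d 1 (2 * k ^ 2 + 1)%Z (2 * k)%Z.
Proof.
  subst d; split.
  - unfold is_positive_solution, is_solution.
    split; [ring | split; nia].
  - intros a b hsol hne.
    destruct (positive_solution_lower_bound k a b hk hsol) as [ha hb].
    apply quad_val_lt; [nia | assumption ..].
Qed.
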